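(* Let $H$ be a locally compact abelian topological group, let $\Lambda\subseteq \mathbb{R}^d\times H$ be a subgroup such that the quotient $(\mathbb{R}^d\times H)/\Lambda$ is compact, let $\pi:\mathbb{R}^d\times H\to\mathbb{R}^d$ and $\pi':\mathbb{R}^d\times H\to H$ be the projections, let $K\subseteq H$ be a non-empty bounded subset, and let $\mathcal{D}_K=\{\pi(x) : x\in\Lambda,\ \pi'(x)\in K\}$ be the corresponding model set. Assume: (i) the restriction of $\pi$ to $\Lambda$ is injective; (ii) the restriction of $\pi'$ to $\Lambda$ is injective; (iii) $G=\pi'(\Lambda)$ is dense in $H$; (iv) $K$ is the closure of its interior. Assume in addition that $H$ is connected and simply connected, and that $K$ contains an open path-connected subset $V$ such that $$1\in V\subseteq K\subseteq \bigcup_{s\in V} sV ,$$ where the group operation of $H$ is written multiplicatively with identity $1$ in this last condition. Then the universal group of the point-set semigroup $\Gamma(\mathcal{D}_K)$ is isomorphic to $G$.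
   Context: Bounded means relatively compact. Partial semigroups. A semigroup here is a set with a partial binary operation such that $(st)u$ exists if and only if $s(tu)$ exists, in which case they are equal. Point-set semigroup. For $\mathcal{D}\subseteq\mathbb{R}^d$, consider all triples $(p_2,P,p_1)$ with $P\subseteq\mathcal{D}$ finite and $p_1,p_2\in P$. Two triples are identified if one is obtained from the other by a translation: $(p_2,P,p_1)\sim(p_2+g,P+g,p_1+g)$ for $g\in\mathbb{R}^d$ with $P+g\subseteq\mathcal{D}$. The set of classes $[p_2,P,p_1]$ is $\Gamma(\mathcal{D})$. The product $[p_2,P,p_1][q_2,Q,q_1]$ is defined iff there are $g,h\in\mathbb{R}^d$ with $P+g\subseteq\mathcal{D}$, $Q+h\subseteq\mathcal{D}$ and $p_1+g=q_2+h$; it is then $[p_2+g,(P+g)\cup(Q+h),q_1+h]$. This makes $\Gamma(\mathcal{D})$ an inverse semigroup (with partial operation). Universal group. For a set $S$ with a partial binary operation $\circ$, the universal group of $S$ is the quotient of the free group on $S$ by the congruence generated by all pairs $((s)\cdot(t),(s\circ t))$ with $s\circ t$ defined; equivalently it is the group universal for maps $\theta$ from $S$ to groups satisfying $\theta(s\circ t)=\theta(s)\theta(t)$ whenever $s\circ t$ is defined. *)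

(* Defs.v *)
From HB Require Import structures.
From mathcomp Require Import all_boot all_order all_algebra.
From mathcomp Require Import monoid generic_quotient finmap.
From mathcomp Require Import all_classical reals topology normedtype.

Set Implicit Arguments.
Unset Strict Implicit.
Unset Printing Implicit Defensive.

Import Order.TTheory GRing.Theory Num.Theory.
Import numFieldTopology.Exports.

Local Open Scope classical_set_scope.
Local Open Scope ring_scope.
Local Open Scope quotient_scope.

Section PathsAndLoops.
Variable R : realType.

Definition path_connected (T : topologicalType) (A : set T) : Prop :=
  forall x y : T, A x -> A y ->
    exists g : R -> T,
      [/\ {within `[0, 1], continuous g}, g 0 = x, g 1 = y
        & forall t, t \in `[0, 1] -> A (g t)].

(* The homotopy (its first argument is the parameter) keeps both endpoints of
   the loop g at the base point g 0. *)
Definition null_homotopic (T : topologicalType) (g : R -> T) : Prop :=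
  exists F : R * R -> T,
    [/\ {within `[0, 1] `*` `[0, 1], continuous F},
        forall t, t \in `[0, 1] -> F (0, t) = g t,
        forall t, t \in `[0, 1] -> F (1, t) = g 0
      & forall s, s \in `[0, 1] -> F (s, 0) = g 0 /\ F (s, 1) = g 0].

Definition simply_connected (T : topologicalType) : Prop :=
  path_connected [set: T] /\
  forall g : R -> T, {within `[0, 1], continuous g} -> g 0 = g 1 ->
    null_homotopic g.

End PathsAndLoops.

Section Congruences.
Variable M : ChoiceMagma.type.
Implicit Types (E r : M -> M -> Prop) (x y : M).

Definition congruence E : Prop :=
  [/\ forall x, E x x,
      forall x y, E x y -> E y x,
      forall x y z, E x y -> E y z -> E x z
    & forall x x' y y', E x x' -> E y y' -> E (x * y)%g (x' * y')%g].

Definition gen_congruence r x y : Prop :=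
  forall E, congruence E -> (forall u v, r u v -> E u v) -> E x y.

Lemma gen_congruenceP r : congruence (gen_congruence r).
Proof.
split.
- by move=> x E [Er _ _ _] _; exact: Er.
- by move=> x y xy E cE rE; have [_ Es _ _] := cE; apply: Es; apply: xy.
- move=> x y z xy yz E cE rE; have [_ _ Et _] := cE.
  by apply: (Et _ y); [apply: xy|apply: yz].
- move=> x x' y y' xx yy E cE rE; have [_ _ _ Em] := cE.
  by apply: Em; [apply: xx|apply: yy].
Qed.

Lemma sub_gen_congruence r x y : r x y -> gen_congruence r x y.
Proof. by move=> rxy E _; apply. Qed.

Definition gen_congruenceb r x y : bool := `[< gen_congruence r x y >].

Lemma gen_congruenceb_equiv r : equiv_class_of (gen_congruenceb r).
Proof.
have [Er Es Et _] := gen_congruenceP r; split=> [x|x y|y x z].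
- exact/asboolP.
- by apply/asboolP/asboolP; apply: Es.
- by move=> /asboolP xy /asboolP yz; apply/asboolP; apply: Et xy yz.
Qed.

Canonical gen_congruenceb_equiv_rel r :=
  EquivRelPack (gen_congruenceb_equiv r).
Canonical gen_congruenceb_encModRel r := defaultEncModRel (gen_congruenceb r).

Definition cquot r := {eq_quot gen_congruenceb r}.
HB.instance Definition _ r :=
  EqQuotient.on (cquot r).
HB.instance Definition _ r := Choice.on (cquot r).

Variable r : M -> M -> Prop.

Lemma cquotP x y : \pi_(cquot r) x = \pi_(cquot r) y <-> gen_congruence r x y.
Proof.
by split=> [/eqP|xy]; [rewrite eqquotE => /asboolP|
  apply/eqP; rewrite eqquotE; apply/asboolP].
Qed.

Definition cquot_mul (a b : cquot r) : cquot r :=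
  \pi_(cquot r) (repr a * repr b)%g.

Lemma cquot_mulE x y :
  cquot_mul (\pi_(cquot r) x) (\pi_(cquot r) y) = \pi_(cquot r) (x * y)%g.
Proof.
apply/cquotP; have [_ _ _ Em] := gen_congruenceP r.
by apply: Em; apply/cquotP; rewrite reprK.
Qed.

End Congruences.

Section QuotientMonoid.
Variables (M : monoidType) (r : M -> M -> Prop).

Let one : cquot r := \pi_(cquot r) 1%g.

Lemma cquot_mulA : associative (@cquot_mul M r).
Proof.
elim/quotW => x; elim/quotW => y; elim/quotW => z.
by rewrite (cquot_mulE r y z) (cquot_mulE r x y) (cquot_mulE r x) cquot_mulE mulgA.
Qed.

Lemma cquot_mul1g : left_id one (@cquot_mul M r).
Proof. by elim/quotW => x; rewrite cquot_mulE mul1g. Qed.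

Lemma cquot_mulg1 : right_id one (@cquot_mul M r).
Proof. by elim/quotW => x; rewrite cquot_mulE mulg1. Qed.

End QuotientMonoid.

(* The free group on X is the free monoid on X * bool, where (x, false)
   stands for the formal inverse of (x, true), modulo cancellation. *)
Section FreeGroup.
Variable X : choiceType.

Definition fg_word : Type := seq (X * bool).
HB.instance Definition _ := Choice.on fg_word.
HB.instance Definition _ := isMonoid.Build fg_word
  (@catA (X * bool)) (@cat0s (X * bool)) (@cats0 (X * bool)).

Definition fg_cancel (u v : fg_word) : Prop :=
  exists (x : X) (b : bool), u = [:: (x, b); (x, ~~ b)] /\ v = [::].

Definition free_group : Type := cquot fg_cancel.
HB.instance Definition _ := EqQuotient.on free_group.
HB.instance Definition _ := Choice.on free_group.

Definition fg_letter_inv (l : X * bool) : X * bool := (l.1, ~~ l.2).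
Definition fg_word_inv (w : fg_word) : fg_word := rev (map fg_letter_inv w).

Lemma fg_letter_invK : involutive fg_letter_inv.
Proof. by case=> x b; rewrite /fg_letter_inv /= negbK. Qed.

Lemma fg_word_invK : involutive fg_word_inv.
Proof.
by move=> w; rewrite /fg_word_inv map_rev revK -map_comp map_id_in // => l _;
   rewrite /= fg_letter_invK.
Qed.

Lemma fg_word_mulV (w : fg_word) :
  gen_congruence fg_cancel (w * fg_word_inv w)%g 1%g.
Proof.
have [Er Es Et Em] := gen_congruenceP fg_cancel.
elim: w => [|[x b] w IHw]; first exact: Er.
have -> : ((((x, b) :: w) : fg_word) * fg_word_inv ((x, b) :: w))%g
    = (([:: (x, b)] : fg_word) *
        (((w : fg_word) * fg_word_inv w) * ([:: (x, ~~ b)] : fg_word)))%g.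
  by rewrite /fg_word_inv /= rev_cons -cats1 /mul /= -!catA.
apply: (Et _ (([:: (x, b)] : fg_word) * (1 * ([:: (x, ~~ b)] : fg_word)))%g).
  by apply: (Em); [exact: Er|apply: (Em); [exact: IHw|exact: Er]].
by apply: sub_gen_congruence; exists x, b.
Qed.

Lemma fg_word_inv_congr (u v : fg_word) : gen_congruence fg_cancel u v ->
  gen_congruence fg_cancel (fg_word_inv u) (fg_word_inv v).
Proof.
have [Er Es Et Em] := gen_congruenceP fg_cancel => uv.
have Vu : gen_congruence fg_cancel (fg_word_inv u * u)%g 1%g.
  by rewrite -{2}[u]fg_word_invK; exact: fg_word_mulV.
have := Em _ _ _ _ (Er (fg_word_inv u)) (fg_word_mulV v).
rewrite mulg1 => /Es h1; apply: (Et _ _ _ h1); rewrite mulgA.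
rewrite -[X in gen_congruence _ _ X]mul1g; apply: (Em); last exact: Er.
by apply: (Et) Vu; apply: (Em); [exact: Er|exact: Es].
Qed.

Definition fg_inv (a : free_group) : free_group := \pi_free_group (fg_word_inv (repr a)).

Lemma fg_invE (w : fg_word) :
  fg_inv (\pi_free_group w) = \pi_free_group (fg_word_inv w).
Proof.
apply/cquotP; apply: fg_word_inv_congr; apply: (proj1 (cquotP _ _ _)).
exact: (@reprK _ free_group).
Qed.

Lemma fg_mulVg :
  left_inverse (\pi_free_group 1%g) fg_inv (@cquot_mul _ fg_cancel).
Proof.
elim/quotW => w; rewrite fg_invE cquot_mulE; apply/cquotP.
by rewrite -{2}[w]fg_word_invK; exact: fg_word_mulV.
Qed.

Lemma fg_mulgV :
  right_inverse (\pi_free_group 1%g) fg_inv (@cquot_mul _ fg_cancel).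
Proof.
elim/quotW => w; rewrite fg_invE cquot_mulE; apply/cquotP.
exact: fg_word_mulV.
Qed.

HB.instance Definition _ := isGroup.Build free_group
  (@cquot_mulA _ fg_cancel) (@cquot_mul1g _ fg_cancel)
  (@cquot_mulg1 _ fg_cancel) fg_mulVg fg_mulgV.

Definition fg_gen (x : X) : free_group := \pi_free_group ([:: (x, true)] : fg_word).

End FreeGroup.

(* The universal group of a set S with a partial operation op, where
   op s t = None means that the product of s and t is undefined. *)
Section UniversalGroup.
Variables (S : choiceType) (op : S -> S -> option S).

Definition ug_rel (u v : free_group S) : Prop :=
  exists s t w : S,
    [/\ op s t = Some w, u = (fg_gen s * fg_gen t)%g & v = fg_gen w].

Definition universal_group : Type := cquot ug_rel.
HB.instance Definition _ := EqQuotient.on universal_group.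
HB.instance Definition _ := Choice.on universal_group.

Definition ug_inv (a : universal_group) : universal_group :=
  \pi_universal_group ((repr a)^-1)%g.

Lemma ug_invE (x : free_group S) :
  ug_inv (\pi_universal_group x) = \pi_universal_group (x^-1)%g.
Proof.
apply/cquotP; have [Er Es _ Em] := gen_congruenceP ug_rel.
set y := repr _; have yx : gen_congruence ug_rel y x.
  by apply: (proj1 (cquotP _ _ _)); exact: (@reprK _ universal_group).
have := Em _ _ _ _ (Er y^-1%g) (Em _ _ _ _ yx (Er x^-1%g)).
by rewrite mulgA mulVg mul1g mulgV mulg1 => /Es.
Qed.

Lemma ug_mulVg :
  left_inverse (\pi_universal_group 1%g) ug_inv (@cquot_mul _ ug_rel).
Proof. by elim/quotW => x; rewrite ug_invE cquot_mulE mulVg. Qed.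

Lemma ug_mulgV :
  right_inverse (\pi_universal_group 1%g) ug_inv (@cquot_mul _ ug_rel).
Proof. by elim/quotW => x; rewrite ug_invE cquot_mulE mulgV. Qed.

HB.instance Definition _ := isGroup.Build universal_group
  (@cquot_mulA _ ug_rel) (@cquot_mul1g _ ug_rel)
  (@cquot_mulg1 _ ug_rel) ug_mulVg ug_mulgV.

Definition ug_gen (s : S) : universal_group := \pi_universal_group (fg_gen s).

End UniversalGroup.

Section PointSetSemigroup.
Variables (E : zmodType) (D : set E).

Definition translate (g : E) (P : {fset E}) : {fset E} :=
  [fset (x + g)%R | x in P]%fset.

(* (p2, P, p1), with P a finite subset of D containing both p1 and p2 *)
Definition pattern_pred (t : E * {fset E} * E) : bool :=
  let: (p2, P, p1) := t in [&& `[< [set` P] `<=` D >], p2 \in P & p1 \in P].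

Definition pattern : Type := {t | pattern_pred t}.
HB.instance Definition _ := Choice.on pattern.

(* P + g `<=` D is not required explicitly: u is itself a pattern in D. *)
Definition translates (t u : pattern) : bool :=
  let: (p2, P, p1) := val t in
  `[< exists g : E, val u = (p2 + g, translate g P, p1 + g) >].

Lemma translate0 P : translate 0 P = P.
Proof.
apply/fsetP => x; apply/imfsetP/idP => /= [[y yP ->]|xP]; first by rewrite addr0.
by exists x; rewrite ?addr0.
Qed.

Lemma translateD g h P : translate h (translate g P) = translate (g + h) P.
Proof.
apply/fsetP => x; apply/imfsetP/imfsetP => /= -[y].
  by move=> /imfsetP[/= z zP ->] ->; exists z; rewrite ?addrA.
by move=> yP ->; exists (y + g); rewrite ?addrA//; apply/imfsetP; exists y.
Qed.

Lemma translateU g P Q :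
  translate g (P `|` Q)%fset = (translate g P `|` translate g Q)%fset.
Proof. exact: imfsetU. Qed.

Lemma translates_equiv : equiv_class_of translates.
Proof.
split=> [[[[a A] b] ?]|[[[a A] b] ?] [[[c C] d] ?]
        |[[[a A] b] ?] [[[c C] d] ?] [[[e F] f] ?]]; rewrite /translates /=.
- by apply/asboolP; exists 0; rewrite !addr0 translate0.
- by apply/asboolP/asboolP; move=> [g [-> -> ->]]; exists (- g);
     rewrite !addrK translateD subrr translate0.
- move=> /asboolP[g [-> -> ->]] /asboolP[h [-> -> ->]]; apply/asboolP.
  by exists (g + h); rewrite !addrA translateD.
Qed.

Canonical translates_equiv_rel := EquivRelPack translates_equiv.
Canonical translates_encModRel := defaultEncModRel translates.

Definition Gamma : Type := {eq_quot translates}.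
HB.instance Definition _ := EqQuotient.on Gamma.
HB.instance Definition _ := Choice.on Gamma.

(* Graph of the partial product; t and u range over all representatives of the
   classes a and b. Gamma_product_functional is its well-definedness. *)
Definition Gamma_product (a b c : Gamma) : Prop :=
  exists (t u w : pattern) (g h : E),
    let: (p2, P, p1) := val t in
    let: (q2, Q, q1) := val u in
    [/\ a = \pi_Gamma t /\ b = \pi_Gamma u,
        [set` translate g P] `<=` D /\ [set` translate h Q] `<=` D,
        p1 + g = q2 + h,
        val w = (p2 + g, (translate g P `|` translate h Q)%fset, q1 + h)
      & c = \pi_Gamma w].

Lemma Gamma_product_functional a b c c' :
  Gamma_product a b c -> Gamma_product a b c' -> c = c'.
Proof.
move=> [[[[p2 P] p1] pP] [[[[q2 Q] q1] qQ] [w [g [h /=]]]]].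
move=> [[-> ->] _ pq wE ->].
move=> [[[[p2' P'] p1'] pP'] [[[[q2' Q'] q1'] qQ'] [w' [g' [h' /=]]]]].
move=> [[/eqmodP/asboolP /= [k [-> -> ->]] /eqmodP/asboolP /= [l [-> -> ->]]]].
move=> _ pq' wE' ->.
apply/eqmodP; rewrite /= /translates /= wE; apply/asboolP; exists (k + g' - g).
have e1 : g + (k + g' - g) = k + g' by rewrite addrC subrK.
have e2 : h + (k + g' - g) = l + h'.
  apply: (addrI q2); rewrite [RHS]addrA -pq' addrA -pq.
  by rewrite -addrA e1 addrA.
move: (k + g' - g) e1 e2 => m e1 e2.
by rewrite wE' translateU !translateD -!addrA e1 e2.
Qed.

Definition Gamma_mul (a b : Gamma) : option Gamma :=
  if pselect (exists c, Gamma_product a b c) is left ex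
  then Some (projT1 (cid ex)) else None.

Lemma Gamma_mulP a b c : Gamma_mul a b = Some c <-> Gamma_product a b c.
Proof.
rewrite /Gamma_mul; case: pselect => [ex|nex]; last first.
  by split=> // abc; case: nex; exists c.
case: cid => c' /= abc'; split=> [[<-//]|abc].
by congr Some; exact: Gamma_product_functional abc' abc.
Qed.

End PointSetSemigroup.

Definition model_set (E H : zmodType) (L : {pred (E * H)%type}) (K : set H) :
    set E :=
  [set x.1 | x in [set x : E * H | x \in L /\ K x.2]].

(* Main.v *)
Require Import Defs.
From HB Require Import structures.
From mathcomp Require Import all_boot all_order all_algebra.
From mathcomp Require Import monoid generic_quotient ring_quotient finmap.
From mathcomp Require Import all_classical reals topology normedtype.

Set Implicit Arguments.
Unset Strict Implicit.
Unset Printing Implicit Defensive.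

Import Order.TTheory GRing.Theory Num.Theory.
Import numFieldTopology.Exports numFieldNormedType.Exports.
Local Open Scope classical_set_scope.
Local Open Scope ring_scope.

(** In the universal group, the class of [p,P,q] does not depend on P (enlarge P
    by an idempotent, which becomes 1), so it is an edge e(p,q) that satisfies
    e(p,q) e(q,r) = e(p,r) and is invariant under translation.  Writing x* for
    the star map of the lattice, the displacement p* - q* induces a homomorphism
    f to G, and x |-> phi x := e(y,0), with y* = x, is a local homomorphism on
    the points of G in K: phi (x + y) = phi x phi y when x, y, x + y are in K.
    The map f is onto because H is connected, so that its dense subgroup G is
    generated by the points of G in V.

    For injectivity, phi is a cocycle on V that defines a covering of H whose
    fibre is the universal group.  The pairs (f x, x) are exactly endpoints of
    lifts of paths issued from 0: this holds for (v, phi v) with v in V, by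
    lifting a path inside V, and it is preserved by products and inverses, while
    K-points are sums of two V-points.  If f x = 0 the path is a loop; lifting a
    null homotopy of it shows that its lift is closed, that is x = 1. *)

(** * Continuity, connectedness and subdivision of the interval *)

Lemma continuous_add (X : topologicalType) (W : topologicalZmodType)
    (f g : X -> W) :
  continuous f -> continuous g -> continuous (fun x => f x + g x).
Proof.
move=> fc gc x; exact: (continuous2_cvg (h := fun a b : W => a + b) _
  (@add_continuous W (f x, g x)) (fc x) (gc x)).
Qed.

Lemma continuous_sub (X : topologicalType) (W : topologicalZmodType)
    (f g : X -> W) :
  continuous f -> continuous g -> continuous (fun x => f x - g x).
Proof.
move=> fc gc x; exact: (continuous2_cvg (h := fun a b : W => a - b) _
  (@sub_continuous W (f x, g x)) (fc x) (gc x)).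
Qed.

(** [A] meets [Z] in a relatively open set, the trace of the interior of [A -> Z], which is also
    relatively closed, since its complement in [A] is the trace of the interior of [A -> ~ Z]. *)
Lemma connected_locally_constant (X : topologicalType) (A : set X)
    (Z : X -> Prop) : connected A ->
  (forall p, A p -> \forall q \near p, A q -> (Z q <-> Z p)) ->
  forall p q, A p -> A q -> Z p -> Z q.
Proof.
move=> cA lZ p q Ap Aq Zp.
suff : A `&` Z = A by move=> E; have : A q by []; rewrite -E => -[].
apply: cA; first by exists p.
- exists ([set x | A x -> Z x]°); first exact: open_interior.
  apply/seteqP; split=> x [Ax Zx]; split=> //; last exact: (nbhs_singleton Zx).
  by apply: filterS (lZ _ Ax) => y h Ay; apply/h.
- exists (~` [set x | A x -> ~ Z x]°).
    by apply: open_closedC; exact: open_interior.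
  apply/seteqP; split=> x [Ax Zx]; split=> //.
    by move=> /nbhs_singleton /(_ Ax); exact.
  apply: contrapT => nZx; apply: Zx.
  by apply: filterS (lZ _ Ax) => y h Ay /(h Ay).
Qed.

(** This replaces subdivision by a Lebesgue number: if a property of intervals is hereditary,
    additive and locally true, then [P 0 t] is locally constant in [t], and it holds at 0. *)
Lemma segment_induction (R : realType) (P : R -> R -> Prop) :
  (forall a b c d, P a b -> a <= c -> d <= b -> P c d) ->
  (forall a b c, a <= b -> b <= c -> P a b -> P b c -> P a c) ->
  (forall t, exists2 e : R, 0 < e & P (t - e) (t + e)) ->
  P 0 1.
Proof.
move=> Pm Pa Pl.
apply: (connected_locally_constant (@segment_connected R 0 1) _ (p := 0)).
- move=> t; rewrite /= in_itv /= => /andP[t0 t1].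
  have [e e0 Pe] := Pl t.
  have tl : t - e < t by rewrite gtrBl.
  have tr : t < t + e by rewrite ltrDl.
  apply: filterS2 (lt_le_nbhsr tl) (lt_le_nbhsl tr) => q q2 q3.
  rewrite in_itv /= => /andP[q0 q1].
  have te : t <= t + e by exact: ltW.
  have te' : t - e <= t by exact: ltW.
  have [qt|/ltW qt] := leP q t; split=> h.
  + by apply: (Pa _ _ _ q0 qt h); exact: Pm Pe _ _.
  + exact: Pm h _ _.
  + exact: Pm h _ _.
  + by apply: (Pa _ _ _ t0 qt h); exact: Pm Pe _ _.
- by rewrite /= in_itv /= lexx ler01.
- by rewrite /= in_itv /= lexx ler01.
- have [e e0 Pe] := Pl 0.
  by apply: Pm Pe _ _; rewrite ?add0r ?sub0r ?oppr_le0 ltW.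
Qed.

Section Unit.
Variable R : realType.

(** The retraction of the line onto the unit interval. Precomposing with it makes paths and
    homotopies continuous on the whole line or plane, as the lifting lemmas require. *)
Definition clamp (t : R) : R := Num.max 0 (Num.min t 1).

Lemma clamp_itv t : clamp t \in `[0, 1].
Proof.
by rewrite in_itv /= /clamp le_max lexx ge_max ler01 ge_min lexx orbT.
Qed.

Lemma clamp_id t : t \in `[0, 1] -> clamp t = t.
Proof. by rewrite in_itv /clamp => /andP[? ?]; rewrite min_l // max_r. Qed.

Lemma clamp_le0 t : t <= 0 -> clamp t = 0.
Proof. by move=> h; rewrite /clamp max_l // ge_min h. Qed.

Lemma clamp_ge1 t : 1 <= t -> clamp t = 1.
Proof. by move=> h; rewrite /clamp min_r // max_r. Qed.

Lemma clamp_continuous : continuous clamp.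
Proof.
move=> t; apply: (@continuous_max R R (fun=> 0) (fun t => Num.min t 1)).
  exact: cst_continuous.
by apply: (@continuous_min R R id (fun=> 1)) => //; exact: cst_continuous.
Qed.

Lemma continuous_comp_within (X Y : topologicalType) (A : set X) (f : X -> Y)
    (r : X -> X) : {within A, continuous f} -> continuous r ->
  (forall x, A (r x)) -> continuous (f \o r).
Proof.
move=> /subspace_continuousP fc rc rA x O /(fc _ (rA x)).
rewrite /nbhs /= /within /= => /rc; rewrite /nbhs /=.
by apply: filterS => y /=; apply.
Qed.
End Unit.

Lemma open_nbhs_sub (H : topologicalZmodType) (V : set H) (h : H) :
  open V -> V 0 ->
  exists2 O : set H, nbhs h O & forall x y, O x -> O y -> V (x - y).
Proof.
move=> Vo V0; have := @sub_continuous H (h, h) V.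
rewrite /= subrr => /(_ (open_nbhs_nbhs (conj Vo V0))) [[A B] /= [hA hB] AB].
exists (A `&` B); first exact: filterI.
by move=> x y [Ax _] [_ By]; exact: (AB (x, y)).
Qed.

(** * Rectangles in the plane and their sides *)

Lemma setXUl (T1 T2 : Type) (A B : set T1) (C : set T2) :
  (A `|` B) `*` C = A `*` C `|` B `*` C.
Proof. by apply/seteqP; split=> -[x y] /=; tauto. Qed.

Lemma setXUr (T1 T2 : Type) (A : set T1) (B C : set T2) :
  A `*` (B `|` C) = A `*` B `|` A `*` C.
Proof. by apply/seteqP; split=> -[x y] /=; tauto. Qed.

Lemma closed_rect (R : realType) (a b c d : R) :
  closed (`[a, b] `*` `[c, d] : set (R * R)).
Proof.
have -> : `[a, b] `*` `[c, d] =
    fst @^-1` `[a, b] `&` snd @^-1` `[c, d] :> set (R * R).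
  by apply/seteqP; split=> -[].
apply: closedI; apply: preimage_closed; try exact: itv_closed.
  by move=> ? _; exact: cvg_fst.
by move=> ? _; exact: cvg_snd.
Qed.

Lemma connected_vertical (R : realType) (b c d : R) :
  connected ([set b] `*` `[c, d] : set (R * R)).
Proof.
have -> : [set b] `*` `[c, d] = (pair b) @` `[c, d] :> set (R * R).
  apply/seteqP; split=> -[x y] /=; first by case=> -> ?; exists y.
  by move=> [z ? [<- <-]].
apply: connected_continuous_connected; first exact: segment_connected.
apply: continuous_subspaceT => x.
by apply: (@cvg_pair _ _ _ (nbhs x) (nbhs b) (nbhs x)) => //; exact: cvg_cst.
Qed.

Lemma connected_horizontal (R : realType) (a b d : R) :
  connected (`[a, b] `*` [set d] : set (R * R)).
Proof.
have -> : `[a, b] `*` [set d] = (pair^~ d) @` `[a, b] :> set (R * R).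
  apply/seteqP; split=> -[x y] /=; first by case=> ? ->; exists x.
  by move=> [z ? [<- <-]].
apply: connected_continuous_connected; first exact: segment_connected.
apply: continuous_subspaceT => x.
by apply: (@cvg_pair _ _ _ (nbhs x) (nbhs x) (nbhs d)) => //; exact: cvg_cst.
Qed.

Lemma itv_split (R : realType) (a b c : R) : a <= b -> b <= c ->
  [set` `[a, c]] = [set` `[a, b]] `|` [set` `[b, c]] /\
  [set` `[a, b]] `&` [set` `[b, c]] = [set b].
Proof.
move=> ab bc; split; apply/seteqP; split=> x /=; rewrite !in_itv /=.
- move=> /andP[ax xc]; have [xb|/ltW bx] := leP x b.
    by left; apply/andP.
  by right; apply/andP.
- case=> /andP[h h']; apply/andP; split=> //; first exact: le_trans bc.
  exact: le_trans h.
- by case=> /andP[_ h] /andP[h' _]; apply: le_anti; apply/andP.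
- by move=> ->; rewrite lexx ab bc.
Qed.

Lemma nbhs_segment (R : realType) (t : R) (P : set R) : nbhs t P ->
  exists2 e : R, 0 < e & `[t - e, t + e] `<=` P.
Proof.
move=> /nbhs_ballP[e /= e0 eP]; exists (e / 2); first exact: divr_gt0.
move=> x; rewrite /= in_itv /= -ler_distlC => h; apply: eP.
by rewrite /ball /= (le_lt_trans h) // ltr_pdivrMr // ltr_pMr // ltr1n.
Qed.

(** * Lifting and monodromy in the covering defined by a cocycle *)

Section Monodromy.
Variables (R : realType) (H : topologicalZmodType) (U : groupType).
Variables (G V : set H) (phi : H -> U).
Hypotheses (GB : forall x y, G x -> G y -> G (x - y)) (G0 : G 0).
Hypotheses (G_dense : dense G) (V_open : open V) (V0 : V 0).
Hypothesis phiD : forall x y, G x -> G y -> V x -> V y -> V (x + y) ->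
  phi (x + y) = (phi x * phi y)%g.

Let phi0 : phi 0 = 1%g.
Proof.
have := @phiD 0 0 G0 G0 V0 V0; rewrite addr0 => /(_ V0) /esym h.
by apply: (mulgI (phi 0)); rewrite mulg1.
Qed.

Lemma dense_near (h : H) (O : set H) : nbhs h O -> exists2 g, G g & O g.
Proof.
move=> hO; have [g [/interior_subset Og Gg]] : O° `&` G !=set0.
  by apply: G_dense; [exists h|exact: open_interior].
by exists g.
Qed.

(* A lift of F along A assigns to x the germ at F x of a function
   g |-> s x g on G that changes by phi (g' - g) from g to g'; this stands for
   a point over F x in the covering of H with fibre U defined by the cocycle
   phi. *)
Definition lift (X : topologicalType) (F : X -> H) (A : set X)
    (s : X -> H -> U) : Prop :=
  forall p, A p -> exists2 O : set H, nbhs (F p) O &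
    \forall q \near p, A q -> forall g g', G g -> G g' -> O g -> O g' ->
      s q g' = (s p g * phi (g' - g))%g.

Section Lift.
Variables (X : topologicalType) (F : X -> H).
Implicit Types (A B : set X) (s : X -> H -> U).

Lemma liftS A B s : B `<=` A -> lift F A s -> lift F B s.
Proof.
move=> BA ls p /BA /ls[O pO near_O]; exists O => //.
by apply: filterS near_O => q h /BA; exact: h.
Qed.

Lemma lift_ext F' A s : (forall p, A p -> F p = F' p) ->
  lift F A s -> lift F' A s.
Proof. by move=> FF ls p Ap; rewrite -FF //; exact: ls. Qed.

Lemma lift_comp (Y : topologicalType) (r : Y -> X) A s : continuous r ->
  lift F A s -> lift (F \o r) (r @^-1` A) (s \o r).
Proof.
move=> rc ls p /ls[O pO near_O]; exists O => //.
exact: (rc p _ near_O).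
Qed.

(** The lifting condition involves only differences [g' - g] and right factors, so it survives a
    translation in [H] and a left multiplication in [U]. *)
Lemma lift_translate A s (w : H) (k : U) : G w -> lift F A s ->
  lift (fun x => F x + w) A (fun x g => k * s x (g - w))%g.
Proof.
move=> Gw ls p /ls[O pO near_O]; exists [set h | O (h - w)] => /=.
  have := @sub_continuous H (F p + w, w) O; rewrite /= addrK => /(_ pO).
  case=> -[P Q] /= [hP hQ] PQ; apply: filterS hP => h Ph.
  by apply: (PQ (h, w)); split=> //; exact: nbhs_singleton hQ.
apply: filterS near_O => q h Aq g g' Gg Gg' Og Og'.
rewrite (h Aq (g - w) (g' - w)) ?mulgA //; try exact: GB.
by rewrite opprB addrA subrK.
Qed.

Hypothesis Fc : continuous F.

(** Equality of germs at [F p]: both lifts pass through the same point of the covering. *)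
Definition lift_agree s s' (p : X) : Prop :=
  exists2 O, nbhs (F p) O & forall g, G g -> O g -> s p g = s' p g.

Lemma near_F (p : X) (O : set H) : nbhs (F p) O ->
  \forall q \near p, nbhs (F q) O.
Proof. by move=> /nbhs_interior pO; exact: Fc pO. Qed.

Lemma lift_germ A s p : A p -> lift F A s -> exists2 O, nbhs (F p) O &
  forall g g', G g -> G g' -> O g -> O g' -> s p g' = (s p g * phi (g' - g))%g.
Proof.
move=> Ap /(_ p Ap)[O pO /nbhs_singleton h]; exists O => // g g'.
exact: h.
Qed.

(** A germ is determined by one of its values, here the one at [F p] itself, which lies in [G]. *)
Lemma lift_agree_at A s s' p g : A p -> lift F A s -> lift F A s' ->
  G g -> F p = g -> (lift_agree s s' p <-> s p g = s' p g).
Proof.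
move=> Ap /(lift_germ Ap)[O pO sO] /(lift_germ Ap)[O' pO' sO'] Gg Fp; split.
  by case=> O2 pO2; apply=> //; rewrite -Fp; exact: nbhs_singleton.
move=> eg; exists (O `&` O'); first exact: filterI.
move=> g' Gg' [Og' Og''].
have Og : O g by rewrite -Fp; exact: nbhs_singleton pO.
have O'g : O' g by rewrite -Fp; exact: nbhs_singleton pO'.
by rewrite (sO g g' Gg Gg' Og Og') (sO' g g' Gg Gg' O'g Og'') eg.
Qed.

(** Uniqueness of lifts. For [q] near [p], density yields a point of [G] at which the germs over [p]
    and over [q] can be compared; both lifts change by the same factor, which cancels. *)
Lemma lift_agree_connected A s s' : connected A -> lift F A s -> lift F A s' ->
  forall p q, A p -> A q -> lift_agree s s' p -> lift_agree s s' q.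
Proof.
move=> cA ls ls'; apply: connected_locally_constant => // p Ap.
have [O pO near_O] := ls p Ap; have [O' pO' near_O'] := ls' p Ap.
have pOO : nbhs (F p) (O `&` O') by exact: filterI.
have sO := nbhs_singleton near_O Ap; have sO' := nbhs_singleton near_O' Ap.
apply: filterS3 near_O near_O' (near_F pOO) => q h h' qOO Aq.
have {}h := h Aq; have {}h' := h' Aq; split=> -[O1 hO1 agr].
  have [g Gg [[Og Og'] O1g]] := dense_near (filterI qOO hO1).
  have e : s p g = s' p g.
    have := agr g Gg O1g.
    by rewrite (h g g Gg Gg Og Og) (h' g g Gg Gg Og' Og') => /mulIg.
  exists (O `&` O') => // g' Gg' [g'O g'O'].
  by rewrite (sO g g' Gg Gg' Og g'O) (sO' g g' Gg Gg' Og' g'O') e.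
have [g Gg [[Og Og'] O1g]] := dense_near (filterI pOO hO1).
exists (O `&` O') => // g' Gg' [g'O g'O'].
by rewrite (h g g' Gg Gg' Og g'O) (h' g g' Gg Gg' Og' g'O') (agr g Gg O1g).
Qed.

(** Away from one closed set only the other lift matters; at a common point the two germs coincide,
    so either lift continues the same germ. *)
Lemma lift_glue A B s s' : closed A -> closed B -> lift F A s -> lift F B s' ->
  (forall p, A p -> B p -> lift_agree s s' p) ->
  lift F (A `|` B) (fun x => if x \in A then s x else s' x).
Proof.
move=> cA cB ls ls' agr p ABp.
have [pA|pA] := pselect (A p); have [pB|pB] := pselect (B p).
- have [O pO near_O] := ls p pA; have [O' pO' near_O'] := ls' p pB.
  have [O2 pO2 e] := agr _ pA pB.
  exists (O `&` O' `&` O2); first exact: filterI (filterI pO pO') pO2.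
  apply: filterS2 near_O near_O' => q h h' ABq g g' Gg Gg' [[Og Og'] O2g].
  move=> [[? ?] ?]; rewrite (mem_set pA); case: ifPn => [/set_mem Aq|].
    exact: h.
  rewrite notin_setE => nAq; rewrite e //; apply: h' => //.
  by case: ABq.
- have [O pO near_O] := ls p pA; exists O => //.
  have nB : nbhs p (~` B).
    by apply: open_nbhs_nbhs; split=> //; exact: closed_openC.
  apply: filterS2 near_O nB => q h nBq ABq.
  have Aq : A q by case: ABq.
  by rewrite (mem_set pA) (mem_set Aq); exact: h.
- have [O pO near_O] := ls' p pB; exists O => //.
  have nA : nbhs p (~` A).
    by apply: open_nbhs_nbhs; split=> //; exact: closed_openC.
  apply: filterS2 near_O nA => q h nAq ABq.
  have Bq : B q by case: ABq.
  by rewrite !memNset //; exact: h.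
- by case: ABp.
Qed.

Lemma liftMl A s k : lift F A s -> lift F A (fun x g => k * s x g)%g.
Proof.
move=> ls p /ls[O pO near_O]; exists O => //; apply: filterS near_O => q h Aq.
by move=> g g' Gg Gg' Og Og'; rewrite (h Aq g g' Gg Gg' Og Og') mulgA.
Qed.

(** A left multiplication, that is a deck transformation, makes the second lift meet the first at
    one common point; uniqueness then makes them agree on the whole intersection. *)
Lemma lift_glue_connected A B : closed A -> closed B -> connected (A `&` B) ->
  A `&` B !=set0 -> (exists s, lift F A s) -> (exists s, lift F B s) ->
  exists s, lift F (A `|` B) s.
Proof.
move=> cA cB cAB [p [Ap Bp]] [s ls] [s' ls'].
have [O pO sO] := lift_germ Ap ls; have [O' pO' sO'] := lift_germ Bp ls'.
have pOO : nbhs (F p) (O `&` O') by exact: filterI.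
have [g Gg [Og Og']] := dense_near pOO.
pose k := (s p g * (s' p g)^-1)%g.
have agr : lift_agree s (fun x g => k * s' x g)%g p.
  exists (O `&` O') => // g' Gg' [g'O g'O'].
  rewrite (sO g g' Gg Gg' Og g'O) (sO' g g' Gg Gg' Og' g'O') /k.
  by rewrite mulgA mulgVK.
have ls2 := liftMl k ls'; eexists; apply: (lift_glue cA cB ls ls2) => q Aq Bq.
apply: (lift_agree_connected cAB _ _ _ _ agr) => //.
  by apply: liftS ls => x [].
by apply: liftS ls2 => x [].
Qed.

(** The covering is trivial over a set whose differences all lie in [V]: there one fixed germ serves
    for all points, by the cocycle identity. *)
Lemma lift_local (p : X) : exists (A : set X) s, nbhs p A /\ lift F A s.
Proof.
have [O pO VO] := open_nbhs_sub (F p) V_open V0.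
have [g0 Gg0 Og0] := dense_near pO.
exists [set q | nbhs (F q) O], (fun _ g => phi (g - g0)); split.
  exact: near_F.
move=> q qO; exists O => //; apply: filterE => q' _ g g' Gg Gg' Og Og'.
have e : g' - g0 = (g - g0) + (g' - g) by rewrite [RHS]addrC subrKA.
rewrite e phiD -?e //; [exact: GB|exact: GB|exact: VO|exact: VO|exact: VO].
Qed.

End Lift.

(** Small rectangles lift locally; they are glued along common sides, first vertically into thin
    strips, then horizontally. *)
Lemma lift_square (F : R * R -> H) : continuous F ->
  exists s, lift F (`[0, 1] `*` `[0, 1]) s.
Proof.
move=> Fc; pose P (a b c d : R) := exists s, lift F (`[a, b] `*` `[c, d]) s.
have PS a b c d a' b' c' d' :
    `[a', b'] `<=` `[a, b] -> `[c', d'] `<=` `[c, d] ->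
    P a b c d -> P a' b' c' d'.
  move=> ab cd [s ls]; exists s; apply: liftS ls => -[x y] /= [/ab ? /cd ?].
  by [].
have sub (a b c d : R) : a <= c -> d <= b -> `[c, d] `<=` `[a, b].
  by move=> ac db; apply: subset_itv; rewrite bnd_simp.
apply: (segment_induction (P := fun a b => P a b 0 1)).
- by move=> a b c d h ac db; apply: PS h => //; exact: sub.
- move=> a b c ab bc h h'; have [E1 E2] := itv_split ab bc.
  rewrite /P E1 setXUl.
  apply: lift_glue_connected => //; try exact: closed_rect.
    by rewrite -setXI E2 setIid; exact: connected_vertical.
  exists (b, 0); split; split; rewrite /= in_itv /= ?lexx ?ler01 ?ab ?bc //.
(* Around the abscissa [t] the width of the strip may depend on the vertical interval; gluing two
   pieces keeps the smaller width. *)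
move=> t; pose Q c d := exists2 e : R, 0 < e & P (t - e) (t + e) c d.
suff : Q 0 1 by [].
apply: (segment_induction (P := Q)).
- move=> a b c d [e e0 h] ac db; exists e => //; apply: PS h => //; exact: sub.
- move=> a b c ab bc [e e0 h] [e' e'0 h']; have [E1 E2] := itv_split ab bc.
  have [e2 [e20 e2e e2e']] : exists e2 : R, [/\ 0 < e2, e2 <= e & e2 <= e'].
    exists (Num.min e e'); rewrite lt_min e0 e'0; split=> //;
    by rewrite ge_min lexx ?orbT.
  exists e2 => //; rewrite /P E1 setXUr.
  apply: lift_glue_connected => //; try exact: closed_rect.
  + by rewrite -setXI E2 setIid; exact: connected_horizontal.
  + exists (t, b); split; split;
      rewrite /= in_itv /= ?lexx ?ab ?bc ?gerBl ?lerDl ?ltW //.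
  + by apply: PS h => //; apply: sub; rewrite ?lerD2l ?lerN2.
  + by apply: PS h' => //; apply: sub; rewrite ?lerD2l ?lerN2.
move=> u; have [A [s [[[B C] /= [tB uC] BC] ls]]] := lift_local Fc (t, u).
have [e e0 eB] := nbhs_segment tB; have [e' e'0 eC] := nbhs_segment uC.
exists e' => //; exists e => //; exists s; apply: liftS ls => -[x y] /= [xB yC].
by apply: BC; split; [exact: eB|exact: eC].
Qed.

(** Over a constant map the transition factor at [g] is [phi 0], which is 1, so the value at [g] is
    locally constant. *)
Lemma lift_constant (X : topologicalType) (F : X -> H) (A : set X) s g :
  connected A -> lift F A s -> G g -> (forall p, A p -> F p = g) ->
  forall p q, A p -> A q -> s p g = s q g.
Proof.
move=> cA ls Gg Fg p q Ap Aq; symmetry.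
apply: (@connected_locally_constant X A (fun x => s x g = s p g)) Ap Aq _ => //.
move=> x Ax; have [O xO near_O] := ls x Ax.
have Og : O g by rewrite -(Fg x Ax); exact: nbhs_singleton xO.
apply: filterS near_O => y h Ay.
by rewrite (h Ay g g Gg Gg Og Og) subrr phi0 mulg1.
Qed.

(** The points of the covering that are endpoints of lifted paths from the base point; a point over
    an element of [G] is recorded by the value of its germ there. *)
Definition reachable (g : H) (u : U) : Prop :=
  exists (gamma : R -> H) (s : R -> H -> U),
    [/\ continuous gamma, lift gamma `[0, 1] s, gamma 0 = 0 /\ gamma 1 = g
      & s 0 0 = 1%g /\ s 1 g = u].

(** Over [V] the function [phi] is itself a germ at every point, so a path inside [V] lifts to the
    constant family [phi]. *)
Lemma reachable_phi (v : H) : path_connected R V -> G v -> V v ->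
  reachable v (phi v).
Proof.
move=> Vpc Gv Vv; have [p [pc p0 p1 pV]] := Vpc 0 v V0 Vv.
exists (p \o @clamp R), (fun _ g => phi g); split.
- by apply: continuous_comp_within pc (@clamp_continuous R) _; exact: clamp_itv.
- move=> t _; set h := (p \o _) t.
  have Vh : V h by apply: pV; exact: clamp_itv.
  have [O hO OV] := open_nbhs_sub h V_open V0.
  exists (O `&` V); first by apply: filterI => //; exact: open_nbhs_nbhs.
  apply: filterE => q _ g g' Gg Gg' [Og Vg] [Og' Vg'].
  have e : g' = g + (g' - g) by rewrite addrC subrK.
  by rewrite {1}e phiD -?e //; [exact: GB|exact: OV].
- by rewrite /= clamp_le0 // clamp_ge1.
- by rewrite phi0.
Qed.

(** The path is reversed and translated by [- w] to start at 0; the factor [y^-1] moves the start of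
    its lift to 1. *)
Lemma reachable_inv (w : H) (y : U) : G w -> reachable w y ->
  reachable (- w) y^-1%g.
Proof.
move=> Gw [gamma [s [gc ls [g0 g1] [s0 s1]]]].
have rc : continuous (fun t : R => 1 - t).
  by apply: (@continuous_sub R R (fun=> 1) id) => t //; exact: cvg_cst.
have GNw : G (- w) by rewrite -sub0r; exact: GB.
have := lift_translate y^-1%g GNw (lift_comp rc ls).
set s' := (X in lift _ _ X) => ls'.
exists (fun t => gamma (1 - t) - w), s'; split.
- apply: continuous_add => t; last exact: cvg_cst.
  exact: (continuous_comp (rc t) (gc _)).
- apply: liftS ls' => t /=; rewrite !in_itv /= subr_ge0 lerBlDr lerDl.
  by move=> /andP[-> ->].
- by rewrite /= subr0 subrr g0 g1 subrr add0r.
- by rewrite /s' /= subr0 !subrr opprK add0r s1 s0 mulVg mulg1.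
Qed.

(** The path to [g] is followed by the path to [w] translated by [g], whose lift is multiplied by
    [u] to begin where the first lift ends. *)
Lemma reachable_mul (g w : H) (u y : U) : G g -> G w ->
  reachable g u -> reachable w y -> reachable (g + w) (u * y)%g.
Proof.
move=> Gg Gw [a [s [ac ls [a0 a1] [s0 s1]]]] [b [r [bc lr [b0 b1] [r0 r1]]]].
pose f (t : R) := clamp (t + t); pose f' (t : R) := clamp (t + t - 1).
have dc : continuous (fun t : R => t + t).
  by apply: (@continuous_add R R id id) => t.
have fc : continuous f.
  by move=> t; exact: (continuous_comp (dc t) (@clamp_continuous R _)).
have f'c : continuous f'.
  have d'c : continuous (fun t : R => t + t - 1).
    apply: (@continuous_sub R R (fun t => t + t) (fun=> 1)) => // t.
    exact: cvg_cst.
  by move=> t; exact: (continuous_comp (d'c t) (@clamp_continuous R _)).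
(* Addition in H replaces pasting: on each half one of the two terms is
   constant. *)
pose c t := a (f t) + b (f' t).
have cc : continuous c.
  apply: continuous_add => t.
    exact: (continuous_comp (fc t) (ac _)).
  exact: (continuous_comp (f'c t) (bc _)).
pose h : R := 2^-1; have hh : h + h = 1 by rewrite [RHS]splitr div1r.
have h0 : 0 <= h by rewrite invr_ge0.
have h1 : h <= 1 by rewrite -hh lerDl.
have left_f' t : t <= h -> f' t = 0.
  by move=> th; apply: clamp_le0; rewrite subr_le0 -hh lerD.
have right_f t : h <= t -> f t = 1.
  by move=> th; apply: clamp_ge1; rewrite -hh lerD.
have [E1 E2] := itv_split h0 h1.
have lA : lift c `[0, h] (fun t => s (f t)).
  apply: (@lift_ext _ (a \o f)) => [t|].
    by rewrite /= in_itv /= => /andP[_ th]; rewrite /c left_f' // b0 addr0.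
  by apply: liftS (lift_comp fc ls) => t _; exact: clamp_itv.
have lB : lift c `[h, 1] (fun t k => u * r (f' t) (k - g))%g.
  apply: (@lift_ext _ (fun t => (b \o f') t + g)) => [t|].
    rewrite /= in_itv /= => /andP[th _].
    by rewrite /c right_f // a1 addrC.
  apply: liftS (lift_translate u Gg (lift_comp f'c lr)) => t _.
  exact: clamp_itv.
have hA : [set` `[0, h]] h by rewrite /= in_itv /= h0 lexx.
have hB : [set` `[h, 1]] h by rewrite /= in_itv /= h1 lexx.
have hAB : [set` `[0, h]] `&` [set` `[h, 1]] `<=` [set h] by rewrite E2.
(* At the midpoint the path is at [g], where both germs take the value [u]. *)
have agr :
    lift_agree c (fun t => s (f t)) (fun t k => u * r (f' t) (k - g))%g h.
  have lA' := liftS (_ : [set h] `<=` _) lA.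
  have lB' := liftS (_ : [set h] `<=` _) lB.
  apply/(@lift_agree_at _ _ [set h] _ _ _ g) => //.
  - by apply: lA' => ? ->.
  - by apply: lB' => ? ->.
  - by rewrite /c left_f' // right_f // a1 b0 addr0.
  - by rewrite left_f' // right_f // s1 subrr r0 mulg1.
have cA : closed [set` `[0, h]] by exact: itv_closed.
have cB : closed [set` `[h, 1]] by exact: itv_closed.
have := lift_glue cA cB lA lB; rewrite -E1 => lAB.
exists c; eexists; split; [exact: cc|apply: lAB| |].
- by move=> t tA tB; have -> : t = h by exact: hAB.
- have f0 : f 0 = 0 by rewrite /f addr0 clamp_le0.
  have f'1 : f' 1 = 1 by rewrite /f' addrK clamp_ge1.
  by rewrite /c f0 left_f' // right_f // f'1 a0 b0 a1 b1 addr0.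
- have f0 : f 0 = 0 by rewrite /f addr0 clamp_le0.
  have f'1 : f' 1 = 1 by rewrite /f' addrK clamp_ge1.
  rewrite mem_set; last by rewrite /= in_itv /= lexx h0.
  rewrite memNset; last first.
    rewrite /= in_itv /= => /andP[_]; rewrite leNgt -hh ltrDl.
    by rewrite invr_gt0 ltr0n.
  by rewrite f0 f'1 s0 (addrC g) addrK r1.
Qed.

(** A null homotopy is constantly 0 on three sides of the square, so its lift has the same value at
    0 at all four corners; the fourth side carries the loop, whose lift is therefore closed. *)
Lemma reachable0 (u : U) : simply_connected R H -> reachable 0 u -> u = 1%g.
Proof.
move=> [_ Hsc] [gamma [s [gc ls [g0 g1] [s0 s1]]]].
have [||F [Fc F0 F1 Fe]] := Hsc gamma.
- exact: continuous_subspaceT.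
- by rewrite g0 g1.
rewrite g0 in F1 Fe.
pose c2 (p : R * R) := (clamp p.1, clamp p.2).
have c2c : continuous c2.
  move=> p.
  apply: (@cvg_pair _ _ _ (nbhs p) (nbhs (clamp p.1)) (nbhs (clamp p.2))).
    apply: (continuous_comp _ (@clamp_continuous R _)); exact: cvg_fst.
  apply: (continuous_comp _ (@clamp_continuous R _)); exact: cvg_snd.
have Fcc : continuous (F \o c2).
  apply: continuous_comp_within Fc c2c _ => p.
  by split; exact: clamp_itv.
have [s' ls'] := lift_square Fcc.
have i0 : (0 : R) \in `[0, 1] by rewrite in_itv /= lexx ler01.
have i1 : (1 : R) \in `[0, 1] by rewrite in_itv /= lexx ler01.
have e1 : s' (0, 0) 0 = s' (1, 0) 0.
  apply: (lift_constant (F := F \o c2)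
    (@connected_horizontal R 0 1 0) _ G0) => //.
  - by apply: liftS ls' => -[x y] /= [? ->].
  - move=> -[x y] /= [xi ->]; rewrite /c2 /= !clamp_id //.
    by have [] := Fe x xi.
have e2 : s' (1, 0) 0 = s' (1, 1) 0.
  apply: (lift_constant (F := F \o c2)
    (@connected_vertical R 1 0 1) _ G0) => //.
  - by apply: liftS ls' => -[x y] /= [-> ?].
  - by move=> -[x y] /= [-> yi]; rewrite /c2 /= !clamp_id // F1.
have e3 : s' (0, 1) 0 = s' (1, 1) 0.
  apply: (lift_constant (F := F \o c2)
    (@connected_horizontal R 0 1 1) _ G0) => //.
  - by apply: liftS ls' => -[x y] /= [? ->].
  - move=> -[x y] /= [xi ->]; rewrite /c2 /= !clamp_id //.
    by have [] := Fe x xi.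
have pc : continuous (fun t : R => (0 : R, t)).
  move=> t; apply: (@cvg_pair _ _ _ (nbhs t) (nbhs (0 : R)) (nbhs t)) => //.
  exact: cvg_cst.
(* The lift along the side of the loop is normalised to start at 1, like [s]. *)
have lp : lift gamma `[0, 1] (fun t k => (s' (0, 0) 0)^-1 * s' (0, t) k)%g.
  apply: liftMl; apply: (@lift_ext _ ((F \o c2) \o (fun t => (0, t)))).
    by move=> t ti; rewrite /= /c2 /= !clamp_id // F0.
  by apply: liftS (lift_comp pc ls') => t ti /=; split.
have I0 : [set` `[(0 : R), 1]] 0 by [].
have I1 : [set` `[(0 : R), 1]] 1 by [].
have i01 := @segment_connected R 0 1.
have agr0 : lift_agree gamma s (fun t k => (s' (0, 0) 0)^-1 * s' (0, t) k)%g 0.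
  by apply/(lift_agree_at I0 ls lp G0 g0); rewrite s0 mulVg.
have := lift_agree_connected gc i01 ls lp I0 I1 agr0.
move=> /(lift_agree_at I1 ls lp G0 g1).
by rewrite s1 e3 e1 e2 mulVg.
Qed.

End Monodromy.

(** * Induction and universal property of the universal group *)

Section UniversalGroupTheory.
Local Open Scope quotient_scope.
Variables (S : choiceType) (op : S -> S -> option S).

Lemma ug_genM (s t w : S) : op s t = Some w ->
  (ug_gen op s * ug_gen op t = ug_gen op w)%g.
Proof.
move=> stw; rewrite [LHS](@cquot_mulE _ (@ug_rel S op)); apply/cquotP.
by apply: sub_gen_congruence; exists s, t, w.
Qed.

(** Every element is represented by a word in the generators and their formal inverses, on which the
    proof inducts. *)
Lemma universal_group_ind (P : universal_group op -> Prop) :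
  P 1%g -> (forall s, P (ug_gen op s)) ->
  (forall x y, P x -> P y -> P (x * y)%g) -> (forall x, P x -> P (x^-1)%g) ->
  forall x, P x.
Proof.
move=> P1 Pg PM PV; elim/quotW; elim/quotW; elim=> [|[s b] w IHw].
  exact: P1.
have -> :
    \pi_(universal_group op) (\pi_(free_group S) ((s, b) :: w : fg_word S)) =
      (\pi_(universal_group op) (\pi_(free_group S) ([:: (s, b)] : fg_word S))
       * \pi_(universal_group op) (\pi_(free_group S) (w : fg_word S)))%g.
  rewrite [RHS](@cquot_mulE _ (@ug_rel S op)); congr (\pi _).
  by rewrite [RHS](@cquot_mulE _ (@fg_cancel S)).
apply: PM => //; case: b; first exact: Pg.
suff -> : \pi_(universal_group op)
    (\pi_(free_group S) ([:: (s, false)] : fg_word S)) = ((ug_gen op s)^-1)%g.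
  exact/PV/Pg.
rewrite [RHS](@ug_invE _ op); congr (\pi _).
by rewrite [RHS](@fg_invE S).
Qed.

Variables (W : zmodType) (theta : S -> W).
Hypothesis thetaM :
  forall s t w, op s t = Some w -> theta w = theta s + theta t.

Let letter (l : S * bool) : W := if l.2 then theta l.1 else - theta l.1.
Let word_sum (w : fg_word S) : W := \sum_(l <- w) letter l.

Let word_sumM (u v : fg_word S) : word_sum (u * v)%g = word_sum u + word_sum v.
Proof. exact: big_cat. Qed.

Let fg_sum (x : free_group S) : W := word_sum (repr x).

Let fg_sumE (w : fg_word S) : fg_sum (\pi_(free_group S) w) = word_sum w.
Proof.
have : gen_congruence (@fg_cancel S) (repr (\pi_(free_group S) w)) w.
  by apply: (proj1 (cquotP _ _ _)); exact: (@reprK _ (free_group S)).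
(* The kernel of [word_sum] is a congruence containing the cancellations, hence it contains the
   congruence they generate. The same argument is used below for [ug_rel]. *)
move=> h; apply: (h (fun u v => word_sum u = word_sum v)); last first.
  move=> _ _ [x [b [-> ->]]]; rewrite /word_sum !big_cons !big_nil addr0.
  by rewrite /letter /=; case: b; rewrite /= ?subrr ?addNr.
split=> //; first by move=> x y z -> ->.
by move=> x x' y y'; rewrite !word_sumM => -> ->.
Qed.

Let fg_sumM (x y : free_group S) : fg_sum (x * y)%g = fg_sum x + fg_sum y.
Proof.
elim/quotW: x => u; elim/quotW: y => v.
by rewrite [X in fg_sum X](@cquot_mulE _ (@fg_cancel S)) !fg_sumE word_sumM.
Qed.

Let fg_sum_gen s : fg_sum (fg_gen s) = theta s.
Proof. by rewrite fg_sumE /word_sum big_seq1. Qed.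

Lemma universal_group_lift : exists f : universal_group op -> W,
  {morph f : x y / (x * y)%g >-> x + y} /\ forall s, f (ug_gen op s) = theta s.
Proof.
pose f (x : universal_group op) := fg_sum (repr x).
have fE x : f (\pi_(universal_group op) x) = fg_sum x.
  have : gen_congruence (@ug_rel S op) (repr (\pi_(universal_group op) x)) x.
    by apply: (proj1 (cquotP _ _ _)); exact: (@reprK _ (universal_group op)).
  move=> h; apply: (h (fun u v => fg_sum u = fg_sum v)); last first.
    move=> _ _ [s [t [w [stw -> ->]]]].
    by rewrite fg_sumM !fg_sum_gen (thetaM stw).
  split=> //; first by move=> ? ? ? -> ->.
  by move=> ? ? ? ?; rewrite !fg_sumM => -> ->.
exists f; split=> [x y|s]; last by rewrite fE fg_sum_gen.
elim/quotW: x => x; elim/quotW: y => y.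
by rewrite [X in f X](@cquot_mulE _ (@ug_rel S op)) !fE fg_sumM.
Qed.

End UniversalGroupTheory.

(** * Edges in the universal group of the point-set semigroup *)

Section PatternClass.
Local Open Scope quotient_scope.
Variables (E : zmodType) (D : set E).
Let U := universal_group (@Gamma_mul E D).
Implicit Types (p q r : E) (P Q : {fset E}).

(** Extended by 1 to triples that are not patterns, so that identities can be written between bare
    triples. *)
Definition pattern_class (t : E * {fset E} * E) : U :=
  if insub t is Some t'
  then ug_gen (@Gamma_mul E D) (\pi_(Gamma D) (t' : pattern D))
  else 1%g.

Lemma pattern_classE (t : pattern D) :
  pattern_class (val t) = ug_gen (@Gamma_mul E D) (\pi_(Gamma D) t).
Proof. by rewrite /pattern_class valK. Qed.

Lemma pattern_predP p P q :
  reflect [/\ [set` P] `<=` D, p \in P & q \in P] (pattern_pred D (p, P, q)).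
Proof.
by apply: (iffP and3P) => -[/asboolP PD pP qP]; split=> //; exact/asboolP.
Qed.

Lemma pattern_class_translate g p P q : pattern_pred D (p, P, q) ->
  pattern_pred D (p + g, translate g P, q + g) ->
  pattern_class (p + g, translate g P, q + g) = pattern_class (p, P, q).
Proof.
move=> h h'.
rewrite -[(p, P, q)](SubK (pattern D) h) -[(p + g, _, _)](SubK (pattern D) h').
rewrite !pattern_classE; congr ug_gen; apply/esym/eqmodP.
by rewrite /= /translates /=; apply/asboolP; exists g.
Qed.

Lemma pattern_classM p P q Q r : pattern_pred D (p, P, q) ->
  pattern_pred D (q, Q, r) ->
  (pattern_class (p, P, q) * pattern_class (q, Q, r))%g =
  pattern_class (p, (P `|` Q)%fset, r).
Proof.
move=> h h'.
have h'' : pattern_pred D (p, (P `|` Q)%fset, r).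
  move: h h' => /pattern_predP[PD pP _] /pattern_predP[QD _ rQ].
  apply/pattern_predP; rewrite !in_fsetU pP rQ orbT; split=> // x /=.
  by rewrite in_fsetU => /orP[/PD|/QD].
rewrite -[(p, P, q)](SubK (pattern D) h) -[(q, Q, r)](SubK (pattern D) h').
rewrite -[(p, _, r)](SubK (pattern D) h'') !pattern_classE.
apply: ug_genM; apply/Gamma_mulP.
exists (Sub _ h), (Sub _ h'), (Sub _ h''), 0, 0 => /=.
have /pattern_predP[PD _ _] := h; have /pattern_predP[QD _ _] := h'.
by split; rewrite ?translate0 ?addr0.
Qed.

(** Such a pattern is idempotent, and 1 is the only idempotent of a group. *)
Lemma pattern_class1 p P : pattern_pred D (p, P, p) ->
  pattern_class (p, P, p) = 1%g.
Proof.
move=> h; apply: (mulgI (pattern_class (p, P, p))).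
by rewrite pattern_classM // fsetUid mulg1.
Qed.

Definition edge p q : U := pattern_class (p, [fset p; q]%fset, q).

Lemma edge_pred p q : D p -> D q -> pattern_pred D (p, [fset p; q]%fset, q).
Proof.
move=> Dp Dq; apply/pattern_predP; rewrite !in_fset2 !eqxx orbT; split=> // x.
by rewrite /= in_fset2 => /orP[] /eqP ->.
Qed.

Lemma pattern_class_edge p P q : pattern_pred D (p, P, q) ->
  pattern_class (p, P, q) = edge p q.
Proof.
move=> /pattern_predP[PD pP qP].
have hqP : pattern_pred D (q, P, q) by exact/pattern_predP.
(* Multiplying the edge by the idempotent of [(q, P, q)] enlarges its point set to [P] without
   changing its class. *)
rewrite -[edge p q]mulg1 -(pattern_class1 hqP) pattern_classM //; last first.
  by apply: edge_pred; exact: PD.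
congr (pattern_class (_, _, _)); apply/esym/fsetUidPr.
by apply/fsubsetP => x; rewrite in_fset2 => /orP[] /eqP ->.
Qed.

Lemma edgeM p q r : D p -> D q -> D r -> (edge p q * edge q r)%g = edge p r.
Proof.
move=> Dp Dq Dr; rewrite pattern_classM; try exact: edge_pred.
apply: pattern_class_edge; apply/pattern_predP.
rewrite !in_fsetU !in_fset1 !eqxx !orbT; split=> // x.
by rewrite /= !in_fsetU !in_fset1 => /orP[] /orP[] /eqP ->.
Qed.

Lemma edge_translate g p q : D p -> D q -> D (p + g) -> D (q + g) ->
  edge (p + g) (q + g) = edge p q.
Proof.
move=> Dp Dq Dpg Dqg.
have e : translate g [fset p; q]%fset = [fset (p + g)%R; (q + g)%R]%fset.
  exact: imfset_fset2.
rewrite /edge -e; apply: pattern_class_translate; rewrite ?e; exact: edge_pred.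
Qed.

End PatternClass.

(** * The star map, displacements and the local homomorphism *)

Section ModelSet.
Local Open Scope quotient_scope.
Variables (E H : zmodType) (L : zmodClosed (E * H)%type) (K : set H).
Hypothesis pi_inj : {in L &, injective fst}.
Hypothesis pi'_inj : {in L &, injective snd}.
Hypothesis K0 : K 0.
Let D := model_set L K.
Let S := Gamma D.
Let U := universal_group (@Gamma_mul E D).
Let G : set H := snd @` [set` L].

(** The star map of the lattice and, next, its inverse; both take the default value 0 outside the
    projections of [L]. *)
Definition star (p : E) : H := xget 0 [set h | (p, h) \in L].
Definition unstar (h : H) : E := xget 0 [set p | (p, h) \in L].

Lemma starE p h : (p, h) \in L -> star p = h.
Proof.
move=> ph; have := @xgetI _ 0 [set h | (p, h) \in L] h ph => /= ph'.
by have [] := pi_inj ph' ph erefl.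
Qed.

Lemma unstarE p h : (p, h) \in L -> unstar h = p.
Proof.
move=> ph; have := @xgetI _ 0 [set p | (p, h) \in L] p ph => /= ph'.
by have [] := pi'_inj ph' ph erefl.
Qed.

Lemma unstar_in h : G h -> (unstar h, h) \in L.
Proof. by move=> [[p k] /= pk <-]; rewrite (unstarE pk). Qed.

Lemma model_set_star p : D p -> (p, star p) \in L /\ K (star p).
Proof. by move=> [[q h] /= [qL Kh] <-]; rewrite (starE qL). Qed.

Lemma model_set_unstar h : G h -> K h -> D (unstar h).
Proof. by move=> /unstar_in hL Kh; exists (unstar h, h). Qed.

Lemma subgroupB x y : G x -> G y -> G (x - y).
Proof.
move=> /unstar_in xL /unstar_in yL.
by exists ((unstar x, x) - (unstar y, y)) => //=; exact: rpredB.
Qed.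

Lemma unstarD x y : G x -> G y -> unstar (x + y) = unstar x + unstar y.
Proof. by move=> /unstar_in xL /unstar_in yL; apply/unstarE/(rpredD xL yL). Qed.

Lemma unstar0 : unstar 0 = 0.
Proof. by apply: unstarE; exact: (rpred0 L). Qed.

(** Both differences lift to elements of [L] with the same first coordinate, which are equal by
    injectivity. Hence [displacement] is invariant under translation of patterns. *)
Lemma star_subr p q p' q' : D p -> D q -> D p' -> D q' -> p - q = p' - q' ->
  star p - star q = star p' - star q'.
Proof.
move=> /model_set_star[pL _] /model_set_star[qL _].
move=> /model_set_star[pL' _] /model_set_star[qL' _] e.
by have [] := pi_inj (rpredB pL qL) (rpredB pL' qL') e.
Qed.

Definition displacement (a : S) : H :=
  star (val (repr a)).1.1 - star (val (repr a)).2.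

Lemma displacementE p P q (h : pattern_pred D (p, P, q)) :
  displacement (\pi_S (Sub (p, P, q) h : pattern D)) = star p - star q.
Proof.
set t : pattern D := Sub _ h.
have : \pi_S (repr (\pi_S t)) = \pi_S t by exact: (@reprK _ S).
rewrite /displacement; case: (repr _) => -[[p' P'] q'] h' /=.
move=> /esym /eqmodP; rewrite /= /translates /= => /asboolP[g [ep _ eq]].
have /pattern_predP[PD pP qP] := h; have /pattern_predP[PD' pP' qP'] := h'.
apply: (star_subr (PD' _ pP') (PD' _ qP') (PD _ pP) (PD _ qP)).
by rewrite ep eq opprD addrACA subrr addr0.
Qed.

(** Once both factors are translated to share their middle point, the star of that point cancels. *)
Lemma displacementM a b c : @Gamma_mul E D a b = Some c ->
  displacement c = displacement a + displacement b.
Proof.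
move=> /Gamma_mulP[[[[p2 P] p1] hP] [[[[q2 Q] q1] hQ] [[[[w2 W] w1] hW]]]].
move=> [g [h /= [[-> ->] [PD QD] e [e2 eW e1] ->]]].
rewrite !displacementE {}e2 {}e1.
have /pattern_predP[PD0 p2P p1P] := hP; have /pattern_predP[QD0 q2Q q1Q] := hQ.
have DP x : x \in P -> D (x + g).
  by move=> xP; apply: PD; apply/imfsetP; exists x.
have DQ x : x \in Q -> D (x + h).
  by move=> xQ; apply: QD; apply/imfsetP; exists x.
have -> : star p2 - star p1 = star (p2 + g) - star (p1 + g).
  apply: star_subr; [exact: PD0|exact: PD0|exact: DP|exact: DP|].
  by rewrite opprD addrACA subrr addr0.
have -> : star q2 - star q1 = star (q2 + h) - star (q1 + h).
  apply: star_subr; [exact: QD0|exact: QD0|exact: DQ|exact: DQ|].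
  by rewrite opprD addrACA subrr addr0.
by rewrite e subrKA.
Qed.

Definition transl (x : H) : U := edge D (unstar x) 0.

Let D0 : D 0.
Proof.
rewrite -unstar0; apply: model_set_unstar => //.
by exists 0 => //=; exact: rpred0.
Qed.

Lemma translD x y : G x -> G y -> K x -> K y -> K (x + y) ->
  transl (x + y) = (transl x * transl y)%g.
Proof.
move=> Gx Gy Kx Ky Kxy; rewrite /transl unstarD //.
have Dx := model_set_unstar Gx Kx; have Dy := model_set_unstar Gy Ky.
have Dxy : D (unstar x + unstar y).
  rewrite -unstarD //; apply: model_set_unstar => //.
  rewrite -[y]opprK -[- y]sub0r; do 2 apply: subgroupB => //.
  by exists 0 => //=; exact: rpred0.
(* The edge from x + y to 0 is cut at y; its first piece is a translate of the edge from x to 0. *)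
rewrite -(edgeM Dxy Dy D0); congr (_ * _)%g.
by rewrite -{2}[unstar y]add0r edge_translate // add0r.
Qed.

Lemma transl_gen x : G x -> K x ->
  exists2 s : S, transl x = ug_gen (@Gamma_mul E D) s & displacement s = x.
Proof.
move=> Gx Kx; have h := edge_pred (model_set_unstar Gx Kx) D0.
exists (\pi_S (Sub _ h : pattern D)); first by rewrite -pattern_classE.
rewrite displacementE (starE (unstar_in Gx)) (@starE 0 0) ?subr0 //.
exact: (rpred0 L).
Qed.

(** The edge from p to q passes through 0, so the values of [transl] generate the universal
    group. *)
Lemma ug_gen_transl (s : S) : exists x y, [/\ G x /\ K x, G y /\ K y,
  ug_gen (@Gamma_mul E D) s = (transl x * (transl y)^-1)%g
  & displacement s = x - y].
Proof.
elim/quotW: s => -[[[p P] q] h].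
have /pattern_predP[PD pP qP] := h.
have [pL Kp] := model_set_star (PD _ pP).
have [qL Kq] := model_set_star (PD _ qP).
exists (star p), (star q); split.
- by split=> //; exists (p, star p).
- by split=> //; exists (q, star q).
- rewrite -pattern_classE /= pattern_class_edge //.
  rewrite /transl (unstarE pL) (unstarE qL); apply: (mulIg (edge D q 0)).
  by rewrite mulgVK edgeM //; exact: PD.
- exact: displacementE.
Qed.

End ModelSet.

(** * Generation by a neighbourhood of 0, and the isomorphism *)

Lemma dense_subgroup_generated (H : topologicalZmodType) (G V I : set H) :
  connected [set: H] -> dense G -> (forall x y, G x -> G y -> G (x - y)) ->
  open V -> V 0 -> (forall x y, I x -> I y -> I (x + y)) ->
  G `&` V `<=` I -> G `<=` I.
Proof.
move=> Hc Gd GB Vo V0 ID VI x Gx.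
pose Z (h : H) := exists2 O : set H, nbhs h O & forall g, G g -> O g -> I g.
suff : Z x by case=> O xO; apply=> //; exact: nbhs_singleton.
apply: (connected_locally_constant Hc _ (p := 0)) => //; last first.
  by exists V => [|g Gg Vg]; [exact: open_nbhs_nbhs|exact: VI].
move=> h _; have [O hO OV] := open_nbhs_sub h Vo V0.
(* One point of [G] near [y] lies in [I] by density, and any other point of [G] in [O] differs from
   it by an element of [V]. *)
have ZO (y : H) : nbhs y O -> Z y -> forall g, G g -> O g -> I g.
  move=> yO [O1 yO1 O1I] g Gg Og.
  have [g1 Gg1 [Og1 O1g1]] := dense_near Gd (filterI yO yO1).
  rewrite -(subrK g1 g); apply: ID; last exact: O1I.
  by apply: VI; split; [exact: GB|exact: OV].
apply: filterS (nbhs_interior hO) => q qO _.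
by split=> [/(ZO _ qO)|/(ZO _ hO)] ?; exists O.
Qed.

Theorem theorem3p4p5 (R : realType) (d : nat) (H : topologicalZmodType)
    (L : zmodClosed ('rV[R]_d * H)%type) (K V : set H)
    (H_lc : locally_compact [set: H])
    (L_cocompact : compact [set: quotient_topology (Quotient.quot L)])
    (K_neq0 : K !=set0)
    (K_bounded : precompact K)
    (pi_inj : {in L &, injective fst})
    (pi'_inj : {in L &, injective snd})
    (G_dense : dense (snd @` [set` L]))
    (K_reg : K = closure (interior K))
    (H_conn : connected [set: H])
    (H_sc : simply_connected R H)
    (V_open : open V)
    (V_pc : path_connected R V)
    (V0 : V 0)
    (VK : V `<=` K)
    (KVV : K `<=` \bigcup_(s in V) [set s + v | v in V]) :
  exists f : universal_group (@Gamma_mul 'rV[R]_d (model_set L K)) -> H,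
    {morph f : x y / (x * y)%g >-> x + y} /\
    set_bij [set: universal_group (@Gamma_mul 'rV[R]_d (model_set L K))]
      (snd @` [set` L]) f.
Proof.
have K0 : K 0 := VK _ V0.
set G := snd @` [set` L] in G_dense *.
have GB x y : G x -> G y -> G (x - y) by exact: (subgroupB pi'_inj).
have G0 : G 0 by exists 0 => //=; exact: rpred0.
have GD x y : G x -> G y -> G (x + y).
  by move=> Gx Gy; rewrite -[y]opprK -[- y]sub0r; exact: GB Gx (GB _ _ G0 Gy).
have [f [fM fgen]] := universal_group_lift
  (displacementM pi_inj (K := K)).
have f1 : f 1%g = 0.
  by apply: (addrI (f 1%g)); rewrite -fM mulg1 addr0.
have fV x : f (x^-1)%g = - f x.
  by apply: (addrI (f x)); rewrite -fM mulgV f1 subrr.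
pose phi := transl L K.
have phiD x y : G x -> G y -> K x -> K y -> K (x + y) ->
    phi (x + y) = (phi x * phi y)%g by exact: translD.
have fphi x : G x -> K x -> f (phi x) = x.
  move=> Gx Kx; have [s es e] := transl_gen pi_inj pi'_inj K0 Gx Kx.
  by rewrite /phi es fgen.
have phiDV x y : G x -> G y -> V x -> V y -> V (x + y) ->
    phi (x + y) = (phi x * phi y)%g.
  by move=> Gx Gy /VK Kx /VK Ky /VK Kxy; exact: phiD.
pose reach := reachable R G phi.
have split_K x : G x -> K x -> exists v w,
    [/\ G v /\ V v, G w /\ V w & x = v + w].
  move=> Gx Kx; have [s Vs [v Vv svx]] := KVV _ Kx.
  have cont : continuous (fun t : H => x - t).
    by apply: continuous_sub => t; [exact: cvg_cst|exact: cvg_id].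
  (* The summand [s] given by [KVV] may lie outside [G]; the splittings of [x] in [V] form a
     neighbourhood of [s], and density provides one in [G]. *)
  have nb : nbhs s (V `&` [set t | V (x - t)]).
    apply: filterI; first exact: open_nbhs_nbhs.
    apply: cont; apply: open_nbhs_nbhs; split=> //.
    by rewrite -svx addrC addKr.
  have [g Gg [Vg Vxg]] := dense_near G_dense nb.
  exists g, (x - g); split=> //; first by split=> //; exact: GB.
  by rewrite addrC subrK.
have reachK x : G x -> K x -> reach x (phi x).
  move=> Gx Kx; have [v [w [[Gv Vv] [Gw Vw] xE]]] := split_K x Gx Kx.
  rewrite xE phiD -?xE //; [|exact: VK|exact: VK].
  rewrite xE; apply: (reachable_mul GB) => //; exact: (reachable_phi (V := V)).
have fG x : G (f x).
  elim/universal_group_ind: x => [|s|x y|x].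
  - by rewrite f1.
  - by have [x [y [[Gx _] [Gy _] _ e]]] := ug_gen_transl pi_inj pi'_inj K0 s;
       rewrite fgen e; exact: GB.
  - by rewrite fM; exact: GD.
  - by rewrite fV -sub0r; exact: GB.
have reachf x : reach (f x) x.
  elim/universal_group_ind: x => [|s|x y hx hy|x hx].
  - have := reachK 0 G0 K0.
    have -> : phi 0 = 1%g.
      by apply: (mulgI (phi 0)); rewrite -phiD ?addr0 ?mulg1.
    by rewrite f1.
  - have [x [y [[Gx Kx] [Gy Ky] es e]]] := ug_gen_transl pi_inj pi'_inj K0 s.
    rewrite fgen e es; apply: (reachable_mul GB) => //.
    + by rewrite -sub0r; exact: GB.
    + exact: reachK.
    + by apply: (reachable_inv GB) => //; exact: reachK.
  - by rewrite fM; exact: reachable_mul.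
  - by rewrite fV; exact: reachable_inv.
exists f; split=> //; split.
- by move=> x _ /=; exact: fG.
(* The quotient of two elements with the same image is the endpoint of the lift of a loop at 0. *)
- move=> x y _ _ fxy; have := reachf (x * y^-1)%g.
  rewrite fM fV fxy subrr => h.
  have := reachable0 GB G0 G_dense V_open V0 phiDV H_sc h.
  by move=> e; apply: (mulIg y^-1%g); rewrite e mulgV.
(* The image of [f] is closed under sums and contains each [v] of [G] in [V], as the image of
   [phi v]. *)
- apply: (dense_subgroup_generated H_conn G_dense GB V_open V0).
    by move=> _ _ [x _ <-] [y _ <-]; exists (x * y)%g.
  by move=> v [Gv Vv]; exists (phi v) => //; rewrite fphi //; exact: VK.
Qed.
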